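(* Let $n$ be a positive integer. The complete graph $K_n$ can be expressed as the matrix product of two graphs (that is, $K_n$ is an MPF graph) if and only if $n = 4k+1$ for some integer $k$.
   Context: All graphs are finite. A simple graph is an undirected graph without loops or multiple edges. A labeling of a graph on $n$ vertices is a bijection from its vertex set to an $n$-element index set such as $\{1,\ldots,n\}$; it determines the $n\times n$ adjacency matrix $A(\cdot)$ of the graph. A simple graph $X$ on $n$ vertices can be expressed as the matrix product of two graphs (is matrix product factorizable, or an MPF graph) if there exist simple graphs $G$ and $H$ on $n$ vertices and labelings of $G$, $H$ and $X$ such that, with respect to these labelings, $A(G)A(H)=A(X)$. *)

(* Defs.v *)
From HB Require Import structures.
From mathcomp Require Import all_boot all_order all_algebra.

Set Implicit Arguments.
Unset Strict Implicit.
Unset Printing Implicit Defensive.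

Import GRing.Theory.
Local Open Scope ring_scope.

Record sgraph := SGraph {
  vertex :> finType;
  adj : rel vertex;
  adj_sym : symmetric adj;
  adj_irrefl : irreflexive adj }.

(* Meaningful when [l] is a labeling, i.e. a bijection onto ['I_n]: then [u]
   and [v] below are the unique vertices labeled [i] and [j]. *)
Definition adjmx (G : sgraph) (n : nat) (l : G -> 'I_n) : 'M[int]_n :=
  \matrix_(i, j) ([exists u, exists v, [&& l u == i, l v == j & adj u v]])%:R.

Definition is_MPF (X : sgraph) : Prop :=
  exists G H : sgraph,
    [/\ #|G| = #|X|, #|H| = #|X| &
     exists (lG : G -> 'I_#|X|) (lH : H -> 'I_#|X|) (lX : X -> 'I_#|X|),
       [/\ bijective lG, bijective lH, bijective lX &
           adjmx lG *m adjmx lH = adjmx lX]].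

Section Complete.
Variable n : nat.

Definition complete_adj : rel 'I_n := fun i j => i != j.

Lemma complete_adj_sym : symmetric complete_adj.
Proof. by move=> i j; rewrite /complete_adj eq_sym. Qed.

Lemma complete_adj_irrefl : irreflexive complete_adj.
Proof. by move=> i; rewrite /complete_adj eqxx. Qed.

Definition complete_graph : sgraph :=
  SGraph complete_adj_sym complete_adj_irrefl.

End Complete.

(* Main.v *)
Require Import Defs.
From mathcomp Require Import all_boot all_order all_algebra.
From mathcomp Require Import zify.

Set Implicit Arguments.
Unset Strict Implicit.
Unset Printing Implicit Defensive.

Import GRing.Theory.

(** Write [J] for the all-ones matrix, so that [K_n] has adjacency matrix
    [J - 1].

    Suppose [A *m B = J - 1] with [A], [B] symmetric with zero diagonal.
    Transposing gives [B *m A = J - 1] too, so [A] and [B] commute with [J]: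
    both graphs are regular, say of degrees [r] and [s], and comparing row sums
    gives [r * s = n - 1].  Both degrees are even: two distinct vertices [u],
    [v] are joined by exactly one walk made of a [G]-edge [u w] followed by an
    [H]-edge [w v]; for [v] in the [G]-neighbourhood of [u] this says that [v]
    has exactly one [H]-neighbour [w] in that same neighbourhood, so [H]
    restricts to a perfect matching of it.  Hence [4] divides [n - 1].
    The parity step is carried out algebraically, in [row_sum_even]: the row
    sum of [A] at [u] is the value of the quadratic form of [B] at row [u] of
    [A], and such a form takes even values ([hollow_form_even]).

    Conversely let [n = 4 * k + 1] and identify the vertices with the integers
    modulo [n].  Take for [G] the cycle, with steps [1] and [-1], and for [H]
    the circulant graph whose steps are the residues in [1 .. 4k] congruent to
    [2] or [3] modulo [4].  The sets [{a - 1, a + 1}], for [a] such a residue,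
    are [{1, 3}], [{2, 4}], [{5, 7}], [{6, 8}] and so on; they tile the nonzero
    residues, so every nonzero difference is in a unique way the sum of a step
    of [G] and a step of [H] ([step23_adj_cycle_neighbours]). *)

Local Open Scope ring_scope.

(** * Hollow symmetric factors of J - 1 *)

Definition hollow_symmetric m (A : 'M[int]_m) : Prop :=
  A^T = A /\ forall i, A i i = 0.

(** The off-diagonal terms come in equal pairs. *)
Lemma hollow_form_even m (B : 'M[int]_m) (x : 'I_m -> int) :
  hollow_symmetric B -> (2 %| \sum_i \sum_j x i * B i j * x j)%Z.
Proof.
move=> [symB diagB].
pose F i j := x i * B i j * x j.
have symF i j : F j i = F i j.
  by rewrite /F -{1}symB mxE [LHS]mulrC [x j * _]mulrC mulrA.
suff -> : \sum_i \sum_j x i * B i j * x j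
          = 2 * \sum_(i < m) \sum_(j < m | (j < i)%N) F i j by exact: dvdz_mulr.
have split_row i : \sum_j F i j =
    \sum_(j < m | (j < i)%N) F i j + \sum_(j < m | (i < j)%N) F i j.
  rewrite (bigID (fun j : 'I_m => (j < i)%N)) /=; congr (_ + _).
  rewrite (bigD1 i) ?ltnn //= {1}/F diagB mulr0 mul0r add0r.
  apply: eq_bigl => j; rewrite -leqNgt [(i < j)%N]ltn_neqAle andbC.
  by rewrite eq_sym.
under eq_bigr do rewrite split_row.
rewrite big_split mulrDl !mul1r; congr (_ + _).
rewrite (exchange_big_dep predT) //=.
by apply: eq_bigr => j _; apply: eq_bigr => i _; exact: symF.
Qed.

(** The entry of [A *m B] at [(u, v)] may be inserted into the row sum at [u],
    since it is [1] wherever [A u v] can be nonzero. *)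
Lemma row_sum_even m (A B : 'M[int]_m) u :
  hollow_symmetric A -> hollow_symmetric B ->
  A *m B = const_mx 1 - 1%:M -> (2 %| \sum_v A u v)%Z.
Proof.
move=> [_ diagA] hollowB eqAB.
suff -> : \sum_v A u v = \sum_w \sum_v A u w * B w v * A u v.
  exact: hollow_form_even.
rewrite exchange_big; apply: eq_bigr => v _ /=.
rewrite -mulr_suml; have := congr1 (fun M : 'M_m => M u v) eqAB.
rewrite !mxE => ->; case: (altP (u =P v)) => [<-|_].
  by rewrite diagA mulr0.
by rewrite subr0 mul1r.
Qed.

(** Commuting with the all-ones matrix is regularity: the [(i, j)] entries of
    the two products are the sum of row [i] and the sum of column [j]. *)
Lemma row_sum_const m (A : 'M[int]_m) i j :
  A^T = A -> A *m const_mx 1 = const_mx 1 *m A ->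
  \sum_k A i k = \sum_k A j k.
Proof.
move=> symA comm; have := congr1 (fun M : 'M_m => M i j) comm.
rewrite !mxE => eq_ij.
transitivity (\sum_k A i k * const_mx (1 : int) k j).
  by apply: eq_bigr => k _; rewrite mxE mulr1.
rewrite eq_ij; apply: eq_bigr => k _.
by rewrite mxE mul1r -{1}symA mxE.
Qed.

(** Constant row sums are what makes [m - 1] a product of two even numbers; it
    is enough to have them for [B]. *)
Lemma hollow_factors_order m (A B : 'M[int]_m) :
  (0 < m)%N -> hollow_symmetric A -> hollow_symmetric B ->
  A *m B = const_mx 1 - 1%:M -> (4 %| m%:Z - 1)%Z.
Proof.
move=> m_gt0 hA hB eqAB; have [[symA _] [symB _]] := (hA, hB).
have eqBA : B *m A = const_mx 1 - 1%:M.
  by rewrite -symA -symB -trmx_mul eqAB linearB /= trmx_const trmx1.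
pose u := Ordinal m_gt0.
have regB w : \sum_v B w v = \sum_v B u v.
  apply: row_sum_const => //.
  have -> : const_mx 1 = A *m B + 1%:M by rewrite eqAB subrK.
  rewrite mulmxDr mulmxDl mulmx1 mul1mx mulmxA; congr (_ *m _ + _).
  by rewrite eqAB eqBA.
suff -> : m%:Z - 1 = (\sum_w A u w) * (\sum_v B u v).
  exact: dvdz_mul (row_sum_even u hA hB eqAB) (row_sum_even u hB hA eqBA).
transitivity (\sum_v (A *m B) u v).
  rewrite eqAB; under eq_bigr do rewrite !mxE.
  rewrite big_split /= sumr_const card_ord -mulr_natr mul1r natz; congr (_ + _).
  rewrite (bigD1 u) //= big1 ?addr0 // => v; rewrite eq_sym.
  by move=> /negbTE ->; rewrite oppr0.
under eq_bigr do rewrite mxE.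
rewrite exchange_big mulr_suml; apply: eq_bigr => w _.
by rewrite -mulr_sumr regB.
Qed.

(** * Adjacency matrices *)

Lemma adjmxE (G : sgraph) n (l : G -> 'I_n) u v :
  injective l -> adjmx l (l u) (l v) = (adj u v)%:R.
Proof.
move=> inj_l; rewrite mxE; congr (_%:R); congr nat_of_bool.
apply/existsP/idP => [[u' /existsP[v' /and3P[]]]|adj_uv].
  by move=> /eqP/inj_l <- /eqP/inj_l <-.
by exists u; apply/existsP; exists v; rewrite !eqxx.
Qed.

Lemma adjmx_hollow_symmetric (G : sgraph) n (l : G -> 'I_n) :
  bijective l -> hollow_symmetric (adjmx l).
Proof.
move=> [l' lK l'K]; have inj_l := can_inj lK.
split=> [|i]; last by rewrite -(l'K i) adjmxE // adj_irrefl.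
by apply/matrixP=> i j; rewrite mxE -(l'K i) -(l'K j) !adjmxE // adj_sym.
Qed.

Lemma adjmx_complete n m (l : complete_graph n -> 'I_m) :
  bijective l -> adjmx l = const_mx 1 - 1%:M.
Proof.
move=> [l' lK l'K]; have inj_l := can_inj lK.
apply/matrixP=> i j; rewrite -(l'K i) -(l'K j) adjmxE // !mxE (inj_eq inj_l).
by rewrite /= /complete_adj; case: eqP; rewrite ?subrr ?subr0.
Qed.

(** * The factorization of the complete graph on 4k + 1 vertices *)

Definition step23 (d : nat) : bool := (2 <= d %% 4)%N.

(** This is the tiling of the integers by the sets [{a - 1, a + 1}] with
    [step23 a], seen from the tiled point [d + 1]. *)
Lemma step23_tiling d : (step23 d + step23 d.+2 = 1)%N.
Proof.
rewrite /step23 -(addn2 d) -modnDml; have := ltn_pmod d (isT : (0 < 4)%N).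
by case: (d %% 4)%N => [|[|[|[|]]]].
Qed.

Lemma step23_reflect k a b : (a + b)%N = (4 * k).+1 -> step23 a = step23 b.
Proof.
move=> sum_ab; have: ((a + b) %% 4 = 1)%N.
  by rewrite sum_ab -addn1 mulnC modnMDl.
rewrite /step23 -modnDm.
move: (ltn_pmod a (isT : (0 < 4)%N)) (ltn_pmod b (isT : (0 < 4)%N)).
by case: (a %% 4)%N => [|[|[|[|]]]] //; case: (b %% 4)%N => [|[|[|[|]]]].
Qed.

Section Factors.
Variable k : nat.
Local Notation n := (4 * k).+1.

(** On a single vertex [ordS] is the identity; the first conjunct removes the
    loop. *)
Definition cycle_adj : rel 'I_n :=
  fun i j => (i != j) && ((j == ordS i) || (i == ordS j)).

Lemma cycle_adj_sym : symmetric cycle_adj.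
Proof. by move=> i j; rewrite /cycle_adj eq_sym orbC. Qed.

Lemma cycle_adj_irrefl : irreflexive cycle_adj.
Proof. by move=> i; rewrite /cycle_adj eqxx. Qed.

Definition cycle_graph : sgraph := SGraph cycle_adj_sym cycle_adj_irrefl.

(** Distance suffices to define this circulant graph: [d |-> n - d] preserves
    [step23], see [step23_reflect]. *)
Definition step23_adj : rel 'I_n := fun i j => step23 `|i - j|%N.

Lemma step23_adj_sym : symmetric step23_adj.
Proof. by move=> i j; rewrite /step23_adj distnC. Qed.

Lemma step23_adj_irrefl : irreflexive step23_adj.
Proof. by move=> i; rewrite /step23_adj distnn. Qed.

Definition step23_graph : sgraph := SGraph step23_adj_sym step23_adj_irrefl.

Lemma val_ordS (i : 'I_n) :
  nat_of_ord (ordS i) = if i == 4 * k :> nat then 0%N else i.+1.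
Proof.
rewrite /=; case: eqP => [->|ne]; first by rewrite modnn.
by rewrite modn_small //; have := ltn_ord i; lia.
Qed.

Lemma val_ord_pred (i : 'I_n) :
  nat_of_ord (ord_pred i) = if i == 0 :> nat then (4 * k)%N else i.-1.
Proof.
rewrite /=; have := ltn_ord i; case: (nat_of_ord i) => [|j] lt_jn /=.
  by rewrite modn_small.
by rewrite modnDr modn_small // ltnW.
Qed.

Lemma step23_adj_ordS (i j : 'I_n) :
  step23_adj (ordS i) j = step23 `|i.+1 - j|%N.
Proof.
rewrite /step23_adj val_ordS; case: eqP => // i_last.
by apply: (@step23_reflect k); have := ltn_ord j; lia.
Qed.

Lemma step23_adj_ord_pred (i j : 'I_n) :
  step23_adj (ord_pred i) j = step23 `|i - j.+1|%N.
Proof.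
rewrite /step23_adj val_ord_pred; case: eqP => [->|i_neq0].
  by apply: (@step23_reflect k); have := ltn_ord j; lia.
by congr step23; lia.
Qed.

(** If [i] and [j] differ, their distance is [d + 1] for some [d]; the distances
    of the cycle-neighbours of [i] to [j] are then [d] and [d + 2], up to
    reflection when the cycle wraps around. *)
Lemma step23_adj_cycle_neighbours (i j : 'I_n) :
  (step23_adj (ordS i) j + step23_adj (ord_pred i) j = (i != j))%N.
Proof.
rewrite step23_adj_ordS step23_adj_ord_pred -val_eqE /=.
case: ltngtP => [lt_ij|lt_ji|->] /=.
- have -> : `|i - j.+1|%N = `|i.+1 - j|%N.+2 by lia.
  exact: step23_tiling.
- have -> : `|i.+1 - j|%N = `|i - j.+1|%N.+2 by lia.
  by rewrite addnC step23_tiling.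
have -> : `|j.+1 - j|%N = 1%N by lia.
by have -> : `|j - j.+1|%N = 1%N by lia.
Qed.

Lemma cycle_step23_walks (i j : 'I_n) :
  \sum_w (cycle_adj i w)%:R * (step23_adj w j)%:R = (i != j)%:R :> int.
Proof.
case: (posnP k) => [k0|k_gt0].
  (* a single vertex: both sides vanish *)
  have all_eq (u v : 'I_n) : u = v.
    by apply: val_inj => /=; have := ltn_ord u; have := ltn_ord v; lia.
  rewrite (all_eq i j) eqxx big1 // => w _.
  by rewrite (all_eq w j) cycle_adj_irrefl mul0r.
have ordS_neq (u : 'I_n) : ordS u != u.
  by apply/eqP=> /(congr1 (@nat_of_ord n)); rewrite val_ordS; case: eqP; lia.
have neighbours w : cycle_adj i w = (w == ordS i) || (w == ord_pred i).
  rewrite /cycle_adj -(can2_eq (@ordSK _) (@ord_predK _)) [ordS w == i]eq_sym.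
  rewrite andb_idl //.
  by case/orP=> /eqP ->; rewrite ?ordS_neq // eq_sym ordS_neq.
have neq_SP : ord_pred i != ordS i.
  apply/eqP=> /(congr1 (@nat_of_ord n)); rewrite val_ordS val_ord_pred.
  by case: eqP; case: eqP; lia.
rewrite (bigD1 (ordS i)) //= (bigD1 (ord_pred i)) //= big1 => [|w].
  by rewrite !neighbours !eqxx orbT !mul1r addr0 -natrD step23_adj_cycle_neighbours.
by rewrite neighbours => /andP[/negbTE -> /negbTE ->]; rewrite mul0r.
Qed.

Lemma complete_graph_MPF : is_MPF (complete_graph n).
Proof.
exists cycle_graph, step23_graph; split=> //.
pose l : 'I_n -> 'I_#|'I_n| := enum_rank; have bij_l : bijective l.
  exact: enum_rank_bij.
have inj_l := bij_inj bij_l; have [l' lK l'K] := bij_l.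
exists l, l, l; split=> //; apply/matrixP=> i j.
rewrite -(l'K i) -(l'K j) mxE (reindex l) /=; last exact: onW_bij.
rewrite (@adjmxE (complete_graph n)) // -[RHS]cycle_step23_walks.
apply: eq_bigr => w _.
by rewrite (@adjmxE cycle_graph) // (@adjmxE step23_graph).
Qed.

End Factors.

Theorem theorem1p3 (n : nat) (hn : (0 < n)%N) :
  is_MPF (complete_graph n) <-> exists k : int, (n%:Z = 4 * k + 1)%R.
Proof.
split=> [[G [H [_ _ [lG [lH [lX [bG bH bX eqGH]]]]]]]|[k def_n]].
  have : (4 %| #|complete_graph n|%:Z - 1)%Z.
    apply: (@hollow_factors_order _ (adjmx lG) (adjmx lH)).
    - by rewrite card_ord.
    - exact: adjmx_hollow_symmetric.
    - exact: adjmx_hollow_symmetric.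
    - by rewrite eqGH adjmx_complete.
  rewrite card_ord => /dvdzP[k def_k]; exists k.
  by rewrite mulrC -def_k subrK.
have -> : n = (4 * `|k|%N).+1 by lia.
exact: complete_graph_MPF.
Qed.
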